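(* Let $\Phi$ be a measurable linear cocycle over $\theta$ with generator $A$. Assume that there exist a $\theta$-invariant measurable subset $\widetilde\Omega\subset\Omega$ of full measure, a $\theta$-invariant random variable $\beta:\Omega\to(0,+\infty)$ and a tempered (with respect to $\theta$) random variable $K:\Omega\to(0,+\infty)$ such that: (S1) for each of $\lambda=\beta$ and $\lambda=-\beta$, the pair $(\ell^\infty_{1/K,\lambda}(\widetilde\Omega\times\mathbb Z),\ell^\infty_{1,\lambda}(\widetilde\Omega\times\mathbb Z))$ is measurably properly admissible for $\Phi$, and additionally there is a $\theta$-invariant random variable $\gamma_\lambda:\Omega\to(0,+\infty)$ such that for all $\omega\in\widetilde\Omega$ and $f=(f(n))_{n\in\mathbb Z}\in\ell^\infty_{1/K(\omega),\lambda(\omega)}(\mathbb Z)$, $$\|x\|_{\ell^\infty_{1,\lambda(\omega)}(\mathbb Z)}\le\gamma_\lambda(\omega)\|f\|_{\ell^\infty_{1/K(\omega),\lambda(\omega)}(\mathbb Z)},$$ where $x=(x(n))_{n\in\mathbb Z}$ is the unique solution in $\ell^\infty_{1,\lambda(\omega)}(\mathbb Z)$ of $x(n+1)=A(\theta^n\omega)x(n)+f(n+1)$, $n\in\mathbb Z$; (S2) the pair $(\ell^\infty_{|1/K,\beta|}(\widetilde\Omega\times\mathbb Z),\ell^\infty_{|1,\beta|}(\widetilde\Omega\times\mathbb Z))$ is properly admissible for $\Phi$. Then $\Phi$ has a tempered exponential dichotomy.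
   Context: Notation. $X=(X,|\cdot|)$ is a separable Banach space; $\mathcal L(X)$ is the Banach space of bounded linear operators on $X$ with operator norm $\|\cdot\|$; $\mathcal R(P)$ is the range of $P$; $\mathbb Z_+$ (resp. $\mathbb Z_-$) is the set of nonnegative (resp. nonpositive) integers. $(\Omega,\mathcal F,\mathbb P)$ is a measure space and $\theta:\Omega\to\Omega$ is an invertible measurable transformation (with measurable inverse) preserving $\mathbb P$. A random variable is a measurable function; a function $g$ on $\Omega$ is $\theta$-invariant if $g(\theta\omega)=g(\omega)$ for all $\omega$. A set $\widetilde\Omega$ is $\theta$-invariant if $\theta(\widetilde\Omega)=\widetilde\Omega$; full measure means null complement. Cocycles. A measurable linear cocycle over $\theta$ is a map $\Phi:\mathbb Z_+\times\Omega\to\mathcal L(X)$ with $\Phi(0,\omega)=\mathrm{Id}$, $\Phi(n+m,\omega)=\Phi(m,\theta^n\omega)\Phi(n,\omega)$ for all $\omega\in\Omega$, $n,m\in\mathbb Z_+$, and such that $\omega\mapsto\Phi(n,\omega)$ is strongly measurable for each $n$ (i.e. $\omega\mapsto\Phi(n,\omega)x$ is measurable for each $x\in X$). Its generator is $A(\omega):=\Phi(1,\omega)$. A random variable $K:\Omega\to(0,+\infty)$ is tempered (with respect to $\theta$) if $\lim_{n\to\pm\infty}\frac{\ln K(\theta^n\omega)}{n}=0$ for $\mathbb P$-a.e. $\omega\in\Omega$. Tempered exponential dichotomy. $\Phi$ has a tempered exponential dichotomy if there is a strongly measurable map $\Pi^s:\widetilde\Omega\to\mathcal L(X)$, defined on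 some $\theta$-invariant set $\widetilde\Omega\subset\Omega$ of full measure, such that, with $\Pi^u(\omega):=\mathrm{Id}-\Pi^s(\omega)$: (i) $\Pi^s(\omega)$ is a projection for every $\omega\in\widetilde\Omega$; (ii) $\Pi^s(\theta^n\omega)\Phi(n,\omega)=\Phi(n,\omega)\Pi^s(\omega)$ for all $\omega\in\widetilde\Omega$, $n\in\mathbb Z_+$; (iii) $\Phi(n,\omega)|_{\mathcal R(\Pi^u(\omega))}$ is an isomorphism from $\mathcal R(\Pi^u(\omega))$ onto $\mathcal R(\Pi^u(\theta^n\omega))$ for all $\omega\in\widetilde\Omega$, $n\in\mathbb Z_+$, and $\omega\mapsto\Phi(n,\omega)\Pi^u(\omega)$ is strongly measurable for $n\in\mathbb Z_-$, where for $n\in\mathbb Z_-$, $\Phi(n,\omega):=(\Phi(-n,\theta^n\omega)|_{\mathcal R(\Pi^u(\theta^n\omega))})^{-1}$; (iv) there are a $\theta$-invariant random variable $\alpha:\Omega\to(0,+\infty)$ (the exponent) and a tempered random variable $K:\Omega\to(0,+\infty)$ (the bound; it need not be the $K$ of the claim) such that $\|\Phi(n,\omega)\Pi^s(\omega)\|\le K(\omega)e^{-\alpha(\omega)n}$ for $\omega\in\widetilde\Omega$, $n\in\mathbb Z_+$, and $\|\Phi(n,\omega)\Pi^u(\omega)\|\le K(\omega)e^{\alpha(\omega)n}$ for $\omega\in\widetilde\Omega$, $n\in\mathbb Z_-$. Sequence spaces. For random variables $K:\Omega\to(0,+\infty)$, $\beta:\Omega\to\mathbb R$ and $\omega\in\Omega$,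 $\ell^\infty_{1/K(\omega),\beta(\omega)}(\mathbb Z)$ is the Banach space of sequences $f=(f(n))_{n\in\mathbb Z}\subset X$ with finite norm $\sup_{n\in\mathbb Z}(K(\theta^n\omega)e^{-\beta(\omega)n}|f(n)|)$, and $\ell^\infty_{|1/K(\omega),\beta(\omega)|}(\mathbb Z)$ is the Banach space of those with finite norm $\sup_{n\in\mathbb Z}(K(\theta^n\omega)e^{-\beta(\omega)|n|}|f(n)|)$. When $K\equiv1$ they are written $\ell^\infty_{1,\beta(\omega)}(\mathbb Z)$ and $\ell^\infty_{|1,\beta(\omega)|}(\mathbb Z)$. For a $\theta$-invariant measurable $\widetilde\Omega\subset\Omega$, $\ell^\infty_{1/K,\beta}(\widetilde\Omega\times\mathbb Z)$ (resp. $\ell^\infty_{|1/K,\beta|}(\widetilde\Omega\times\mathbb Z)$) is the set of all $f:\widetilde\Omega\times\mathbb Z\to X$ with $f(\omega,\cdot)\in\ell^\infty_{1/K(\omega),\beta(\omega)}(\mathbb Z)$ (resp. $\ell^\infty_{|1/K(\omega),\beta(\omega)|}(\mathbb Z)$) for every $\omega\in\widetilde\Omega$; again $1$ replaces $1/K$ if $K\equiv1$. Admissibility. A pair $(\mathcal Y,\mathcal Z)$ of such classes of functions on $\widetilde\Omega\times\mathbb Z$ is properly admissible for $\Phi$ if for each $f\in\mathcal Y$ there is a unique $x\in\mathcal Z$ with $x(\omega,n+1)=A(\theta^n\omega)x(\omega,n)+f(\omega,n+1)$ for all $n\in\mathbb Z$, $\omega\in\widetilde\Omega$. It is measurably properly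 admissible if moreover, whenever $\omega\mapsto f(\omega,n)$ is measurable for each $n\in\mathbb Z$, the unique $x$ is such that $\omega\mapsto x(\omega,n)$ is measurable for each $n\in\mathbb Z$. *)

(* Defs.v *)
From HB Require Import structures.
From mathcomp Require Import all_boot all_order all_algebra.
From mathcomp Require Import all_classical all_reals all_analysis.

Set Implicit Arguments.
Unset Strict Implicit.
Unset Printing Implicit Defensive.

Import Order.TTheory GRing.Theory Num.Theory.
Import numFieldNormedType.Exports.

Local Open Scope classical_set_scope.
Local Open Scope ring_scope.

Section operators.
Context {R : realType} {X : normedModType R}.

Definition separable : Prop := exists2 D : set X, countable D & dense D.

Definition bounded_on (V : set X) (f : X -> X) : Prop :=
  exists M : R, forall x, V x -> `|f x| <= M * `|x|.

Record bounded_operator := BoundedOperator {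
  bop_linear :> {linear X -> X} ;
  bop_bounded : bounded_on setT bop_linear }.

(* Extended-real valued, so that it applies to maps not known to be bounded:
   a finite upper bound on [opnorm f] asserts boundedness of [f]. *)
Definition opnorm (f : X -> X) : \bar R :=
  ereal_sup [set (`|f x|)%:E | x in [set x : X | `|x| <= 1]].

(* Inverse of the restriction of [f] to [V]; only meaningful on [f @` V] when
   [f] is injective on [V]. *)
Definition inv_on (V : set X) (f : X -> X) : X -> X := 'pinv_(fun=> 0) V f.

(* For [f] linear and [V], [W] subspaces: topological isomorphism. *)
Definition isomorphism_on (V W : set X) (f : X -> X) : Prop :=
  [/\ set_bij V W f, bounded_on V f & bounded_on W (inv_on V f)].

End operators.
Arguments separable {R} X.
Arguments bounded_operator {R} X.

(* Measurability, on the measurable set [D], of an [X]-valued map with respect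
   to the Borel sigma-algebra of [X]. *)
Definition borel_measurable_on {d : measure_display} {Omega : measurableType d}
    {R : realType} {X : normedModType R} (D : set Omega) (g : Omega -> X) :
    Prop :=
  measurable_fun D (g : Omega -> g_sigma_algebraType (@open X)).

Definition strongly_measurable_on {d : measure_display}
    {Omega : measurableType d} {R : realType} {X : normedModType R}
    (D : set Omega) (T : Omega -> X -> X) : Prop :=
  forall x : X, borel_measurable_on D (fun w => T w x).

Record invertible_mpt {d : measure_display} {Omega : measurableType d}
    {R : realType} (P : {measure set Omega -> \bar R}) := InvertibleMpt {
  mpt_fun :> Omega -> Omega ;
  mpt_inv : Omega -> Omega ;
  mpt_funK : cancel mpt_fun mpt_inv ;
  mpt_invK : cancel mpt_inv mpt_fun ;
  mpt_measurable : measurable_fun setT mpt_fun ;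
  mpt_inv_measurable : measurable_fun setT mpt_inv ;
  mpt_preserving : forall A : set Omega, measurable A ->
    P (mpt_fun @^-1` A) = P A }.

Section dynamics.
Context {d : measure_display} {Omega : measurableType d} {R : realType}.
Context {P : {measure set Omega -> \bar R}}.
Variable theta : invertible_mpt P.

Definition iterZ (n : int) (w : Omega) : Omega :=
  match n with
  | Posz k => iter k theta w
  | Negz k => iter k.+1 (mpt_inv theta) w
  end.

Definition invariant_fun (g : Omega -> R) : Prop :=
  forall w, g (theta w) = g w.

Definition invariant_set (W : set Omega) : Prop := theta @` W = W.

Definition full_measure (W : set Omega) : Prop :=
  measurable W /\ P (~` W) = 0%E.

Definition positive_rv (g : Omega -> R) : Prop :=
  measurable_fun setT g /\ forall w, 0 < g w.

Definition tempered (K : Omega -> R) : Prop :=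
  {ae P, forall w,
     (fun n : nat => ln (K (iterZ n%:Z w)) / n%:R) @ \oo --> (0 : R) /\
     (fun n : nat => ln (K (iterZ (- n%:Z) w)) / - n%:R) @ \oo --> (0 : R)}.

Context {X : completeNormedModType R}.

Definition is_cocycle (Phi : nat -> Omega -> bounded_operator X) : Prop :=
  [/\ forall w x, Phi 0%N w x = x,
      forall n m w x,
        Phi (n + m)%N w x = Phi m (iterZ n%:Z w) (Phi n w x) &
      forall n, strongly_measurable_on setT (fun w => Phi n w)].

Definition generator (Phi : nat -> Omega -> bounded_operator X) (w : Omega) :
  bounded_operator X := Phi 1%N w.

Definition compl_proj (Ps : Omega -> bounded_operator X) (w : Omega) (x : X) :
  X := x - Ps w x.

(* [cocycle_bwd Phi Ps n w] is Phi(-n, w), i.e. the inverse of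
   Phi(n, theta^(-n) w) restricted to the range of the unstable projection at
   theta^(-n) w. *)
Definition cocycle_bwd (Phi : nat -> Omega -> bounded_operator X)
    (Ps : Omega -> bounded_operator X) (n : nat) (w : Omega) : X -> X :=
  let w' := iterZ (- n%:Z) w in inv_on (range (compl_proj Ps w')) (Phi n w').

(* [Ps] is a total function on [Omega], constrained only on [W]. *)
Definition tempered_exponential_dichotomy
    (Phi : nat -> Omega -> bounded_operator X) : Prop :=
  exists (W : set Omega) (Ps : Omega -> bounded_operator X),
    let Pu := compl_proj Ps in
    [/\ [/\ invariant_set W, full_measure W &
            strongly_measurable_on W (fun w => Ps w)],
        forall w, W w -> forall x, Ps w (Ps w x) = Ps w x,
        forall w, W w -> forall (n : nat) x,
          Ps (iterZ n%:Z w) (Phi n w x) = Phi n w (Ps w x),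
        (forall w, W w -> forall n : nat,
          isomorphism_on (range (Pu w)) (range (Pu (iterZ n%:Z w))) (Phi n w))
        /\ (forall n : nat, strongly_measurable_on W
              (fun w => cocycle_bwd Phi Ps n w \o Pu w)) &
        exists alpha K : Omega -> R,
          [/\ positive_rv alpha /\ invariant_fun alpha,
              positive_rv K /\ tempered K,
              forall w, W w -> forall n : nat,
                (opnorm (Phi n w \o Ps w) <=
                 (K w * expR (- alpha w * n%:R))%:E)%E &
              forall w, W w -> forall n : nat,
                (opnorm (cocycle_bwd Phi Ps n w \o Pu w) <=
                 (K w * expR (alpha w * - n%:R))%:E)%E]].

(* Norm of l^oo_{1/K(w), b}(Z); a sequence belongs to the space iff this is
   finite. *)
Definition seqnorm (K : Omega -> R) (b : R) (w : Omega) (f : int -> X) :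
    \bar R :=
  ereal_sup (range (fun n : int =>
    (K (iterZ n w) * expR (- b * n%:~R) * `|f n|)%:E)).

(* Norm of l^oo_{|1/K(w), b|}(Z). *)
Definition seqnorm_abs (K : Omega -> R) (b : R) (w : Omega) (f : int -> X) :
    \bar R :=
  ereal_sup (range (fun n : int =>
    (K (iterZ n w) * expR (- b * `|n%:~R|) * `|f n|)%:E)).

(* Functions on W x Z are represented by total functions Omega -> int -> X,
   considered up to equality on W x Z. *)
Definition linfty (W : set Omega) (K b : Omega -> R) :
    set (Omega -> int -> X) :=
  [set f | forall w, W w -> (seqnorm K (b w) w (f w) < +oo)%E].

Definition linfty_abs (W : set Omega) (K b : Omega -> R) :
    set (Omega -> int -> X) :=
  [set f | forall w, W w -> (seqnorm_abs K (b w) w (f w) < +oo)%E].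

Definition solution_at (Phi : nat -> Omega -> bounded_operator X) (w : Omega)
    (f x : int -> X) : Prop :=
  forall n : int, x (n + 1) = generator Phi (iterZ n w) (x n) + f (n + 1).

Definition solution (Phi : nat -> Omega -> bounded_operator X)
    (W : set Omega) (f x : Omega -> int -> X) : Prop :=
  forall w, W w -> solution_at Phi w (f w) (x w).

Definition properly_admissible (Phi : nat -> Omega -> bounded_operator X)
    (W : set Omega) (Y Z : set (Omega -> int -> X)) : Prop :=
  forall f, Y f -> exists x,
    [/\ Z x, solution Phi W f x &
        forall x', Z x' -> solution Phi W f x' ->
          forall w, W w -> forall n, x' w n = x w n].

Definition measurably_properly_admissible
    (Phi : nat -> Omega -> bounded_operator X) (W : set Omega)
    (Y Z : set (Omega -> int -> X)) : Prop :=
  properly_admissible Phi W Y Z /\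
  forall f, Y f -> (forall n, borel_measurable_on W (fun w => f w n)) ->
  forall x, Z x -> solution Phi W f x ->
  forall n, borel_measurable_on W (fun w => x w n).

End dynamics.

Arguments full_measure {d Omega R} P W.

(* Main.v *)
Require Import Defs.
From HB Require Import structures.
From mathcomp Require Import all_boot all_order all_algebra.
From mathcomp Require Import all_classical all_reals all_analysis.
From mathcomp Require Import measurable_realfun zify ring lra.
Set Implicit Arguments.
Unset Strict Implicit.
Unset Printing Implicit Defensive.

Import Order.TTheory GRing.Theory Num.Theory.
Import numFieldNormedType.Exports.
Local Open Scope classical_set_scope.
Local Open Scope ring_scope.

(** The idea is to read the dichotomy off the response of the system to an
    impulse.  Fix [w] and a vector [v], and force the recursion
    x (n + 1) = A (theta^n w) (x n) + f (n + 1) by the sequence [f] equal to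
    [v] at time 0 and to 0 at all other times.

    Admissibility at the rate [beta] provides a solution bounded by a multiple
    of exp (beta n), and admissibility at the rate [- beta] one bounded by a
    multiple of exp (- beta n); both multiples are of the form
    gamma (w) K (w) |v| with gamma invariant, because the norm of the impulse
    is K (w) |v|.  Both solutions grow at most like exp (beta |n|), and in that
    class solutions are unique by the third admissibility assumption.  Hence
    they are the same sequence, which is bounded by
    M (w) exp (- beta |n|) |v|, where M is K times the sum of the two gammas
    ([exists_green]).  No exponential estimate has to be bootstrapped from a
    uniform one: the decay comes entirely from comparing the two weights.

    Call this sequence G w v.  The stable projection is v |-> G w v 0.  All its
    algebraic properties are obtained in the same manner: modify G w v into
    another sequence that grows at most like exp (beta |n|) and is forced by
    an impulse, and identify the two by uniqueness.
    - Cutting G w v off at negative times gives the response to G w v 0, so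
      the map is a projection ([green_idem]).
    - Subtracting v at time 0 moves the impulse to time 1, where it equals
      A (w) v; so the projections commute with the cocycle
      ([green_commute1]).
    - If v is in the unstable space and A (w) v = 0, the same subtraction
      leaves no forcing at all, so the sequence vanishes and v = 0
      ([unstable_inj1]).
    - At times n <= 0 the sequence impulse v - G w v is a backward orbit of
      v - G w v 0 with decay exp (beta n).  Its points are in the unstable
      spaces ([unstable_of_backward_orbit]), so it is the image of v under
      the inverse cocycle composed with the unstable projection
      ([cocycle_bwd_eq]).
    The two norm estimates of the dichotomy are then the bound on G w v, with
    [1 + M] in place of [M] because of the impulse at time 0.  This bound is
    tempered since [M] is a positive invariant multiple of the tempered [K]. *)

(** * Operators and Borel maps *)

Lemma borel_measurable_on_comp {d : measure_display}
    {Omega : measurableType d} {R : realType} {X : normedModType R}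
    (D : set Omega) (g : Omega -> X) (h : X -> X) :
  continuous h -> borel_measurable_on D g -> borel_measurable_on D (h \o g).
Proof.
move=> ch mg mD; apply: (@measurability _ _ Omega
    (g_sigma_algebraType (@open X)) D _ (@open X)) => //.
move=> _ [B oB <-] /=; rewrite comp_preimage.
apply: mg => //; apply: sub_gen_smallest.
by apply: open_comp => // x _; exact: ch.
Qed.

Lemma bounded_operator_of {R : realType} {X : normedModType R} (f : X -> X) :
  linear f -> bounded_on setT f ->
  exists T : bounded_operator X, forall x, T x = f x.
Proof.
move=> lf bf.
pose L := GRing.isLinear.Build R X X *:%R f lf.
pose F : {linear X -> X} := HB.pack f L.
by exists (@BoundedOperator _ _ F bf).
Qed.

Lemma opnorm_le {R : realType} {X : normedModType R} (f : X -> X) (c : R) :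
  0 <= c -> (forall x, `|f x| <= c * `|x|) -> (opnorm f <= c%:E)%E.
Proof.
move=> c0 fc; apply: ge_ereal_sup => _ [x /= x1 <-]; rewrite lee_fin.
by rewrite (le_trans (fc x))// ler_piMr.
Qed.

(** * Orbits of an invertible transformation *)

Section orbits.
Context {d : measure_display} {Omega : measurableType d} {R : realType}.
Context {P : {measure set Omega -> \bar R}} (theta : invertible_mpt P).

Lemma iterZS (n : int) w : iterZ theta (n + 1) w = theta (iterZ theta n w).
Proof.
case: n => [n|[|n]].
- have -> : Posz n + 1 = n.+1 by lia.
  by [].
- by rewrite /= mpt_invK.
- have -> : Negz n.+1 + 1 = Negz n by lia.
  by rewrite /= mpt_invK.
Qed.

Lemma iterZ_pred (n : int) w :
  iterZ theta (n - 1) w = mpt_inv theta (iterZ theta n w).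
Proof. by rewrite -{2}(subrK 1 n) iterZS mpt_funK. Qed.

Lemma iterZD (m n : int) w :
  iterZ theta (m + n) w = iterZ theta n (iterZ theta m w).
Proof.
elim: n => [|n IH|n IH]; first by rewrite addr0.
- have -> : m + n.+1 = m + n + 1 by lia.
  by rewrite iterZS IH.
- have -> : m + - n.+1%:Z = m + - n%:Z - 1 by lia.
  by rewrite iterZ_pred IH -iterZ_pred; congr (iterZ theta _ _); lia.
Qed.

Lemma invariant_set_iterZ (W : set Omega) n w :
  invariant_set theta W -> W w -> W (iterZ theta n w).
Proof.
move=> invW Ww.
elim: n => [//|n IH|n IH].
- have -> : Posz n.+1 = n%:Z + 1 by lia.
  by rewrite iterZS -invW; exists (iterZ theta n w).
- have -> : - n.+1%:Z = - n%:Z - 1 by lia.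
  rewrite iterZ_pred; move: IH; rewrite -{1}invW => -[w' Ww' <-].
  by rewrite mpt_funK.
Qed.

Lemma invariant_fun_iterZ (g : Omega -> R) n w :
  invariant_fun theta g -> g (iterZ theta n w) = g w.
Proof.
move=> invg; elim: n => [//|n IH|n IH].
- have -> : Posz n.+1 = n%:Z + 1 by lia.
  by rewrite iterZS invg.
- have -> : - n.+1%:Z = - n%:Z - 1 by lia.
  by rewrite iterZ_pred -[LHS]invg mpt_invK.
Qed.

End orbits.

(** * Two-sided sequences and solutions of the forced recursion *)

Section sequences.
Context {R : realType} {X : normedModType R}.

Definition impulse (v : X) (n : int) : X := if n == 0 then v else 0.

(** The space l^oo_{|1, c|}(Z) (see [seqnorm_abs1_lty]), as a predicate closed
    under the manipulations of sequences used below. *)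
Definition exp_bounded (b : R) (x : int -> X) : Prop :=
  exists C : R, forall n, `|x n| <= C * expR (b * `|n%:~R|).

Lemma exp_bounded_comb (b a : R) x y :
  exp_bounded b x -> exp_bounded b y -> exp_bounded b (fun n => a *: x n + y n).
Proof.
move=> [C Cx] [D Dy]; exists (`|a| * C + D) => n.
rewrite mulrDl (le_trans (ler_normD _ _))// lerD// normrZ -mulrA.
exact: ler_wpM2l.
Qed.

Lemma exp_bounded_shift (b : R) (m : int) x :
  0 <= b -> exp_bounded b x -> exp_bounded b (fun n => x (m + n)).
Proof.
move=> b0 [C Cx].
have C0 : 0 <= C.
  have := Cx 0; rewrite normr0 mulr0 expR0 mulr1.
  exact: le_trans.
exists (C * expR (b * `|m%:~R|)) => n.
rewrite (le_trans (Cx _))// -mulrA ler_wpM2l// -expRD ler_expR -mulrDr.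
by rewrite ler_wpM2l// intrD ler_normD.
Qed.

Lemma exp_bounded_impulse (b : R) v : exp_bounded b (impulse v).
Proof.
exists `|v| => n; rewrite /impulse; case: eqP => [->|_].
  by rewrite normr0 mulr0 expR0 mulr1.
by rewrite normr0 mulr_ge0// expR_ge0.
Qed.

End sequences.

Section solutions.
Context {d : measure_display} {Omega : measurableType d} {R : realType}.
Context {P : {measure set Omega -> \bar R}} (theta : invertible_mpt P).
Context {X : completeNormedModType R}.
Context (Phi : nat -> Omega -> bounded_operator X).

Lemma solution_at_comb w a f g x y :
  solution_at theta Phi w f x -> solution_at theta Phi w g y ->
  solution_at theta Phi w (fun n => a *: f n + g n)
    (fun n => a *: x n + y n).
Proof. by move=> fx gy n; rewrite fx gy linearP scalerDr addrACA. Qed.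

Lemma solution_at_unique w (c : R) f x y :
  (forall z, exp_bounded c z -> solution_at theta Phi w (fun=> 0) z ->
    forall n, z n = 0) ->
  exp_bounded c x -> exp_bounded c y ->
  solution_at theta Phi w f x -> solution_at theta Phi w f y -> x =1 y.
Proof.
move=> hom0 cx cy sx sy n; apply/eqP.
rewrite -subr_eq0 addrC -scaleN1r; apply/eqP.
apply: (hom0 (fun k => -1 *: y k + x k)); first exact: exp_bounded_comb.
move=> k; rewrite (solution_at_comb (-1) sy sx).
by congr (_ + _); rewrite scaleN1r addNr.
Qed.

(** Only the part of the sequence between [m] and [m + n] has to follow the
    cocycle; this is what is known of a solution on either side of an
    impulse. *)
Lemma orbit_segment w (m : int) (n : nat) (x : int -> X) :
  is_cocycle theta Phi ->
  (forall k : nat, (k < n)%N ->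
    x (m + k + 1) = generator Phi (iterZ theta (m + k) w) (x (m + k))) ->
  x (m + n) = Phi n (iterZ theta m w) (x m).
Proof.
move=> [Phi0 PhiD _]; elim: n => [|n IH] xS; first by rewrite addr0 Phi0.
have -> : m + n.+1 = m + n + 1 by lia.
rewrite xS// IH; last by move=> k kn; apply: xS; lia.
by rewrite -addn1 PhiD /generator iterZD.
Qed.

End solutions.

(** * The dichotomy defined by a decaying impulse response *)

Section green.
Context {d : measure_display} {Omega : measurableType d} {R : realType}.
Context {P : {measure set Omega -> \bar R}} {theta : invertible_mpt P}.
Context {X : completeNormedModType R}.
Context {Phi : nat -> Omega -> bounded_operator X}.
Hypothesis cocyclePhi : is_cocycle theta Phi.
Context {W : set Omega} {b M : Omega -> R} {G : Omega -> X -> int -> X}.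
Hypothesis invW : invariant_set theta W.
Hypothesis b_ge0 : forall w, 0 <= b w.
Hypothesis M_ge0 : forall w, 0 <= M w.
Hypothesis b_inv : invariant_fun theta b.
Hypothesis unique0 : forall w x, W w -> exp_bounded (b w) x ->
  solution_at theta Phi w (fun=> 0) x -> forall n, x n = 0.
Hypothesis solG : forall w v, W w ->
  solution_at theta Phi w (impulse v) (G w v).
Hypothesis decayG : forall w v n, W w ->
  `|G w v n| <= M w * expR (- b w * `|n%:~R|) * `|v|.

Lemma exp_bounded_green w v : W w -> exp_bounded (b w) (G w v).
Proof.
move=> Ww; exists (M w * `|v|) => n; rewrite (le_trans (decayG _ _ Ww))//.
rewrite mulrAC ler_wpM2l ?mulr_ge0// ler_expR ler_wpM2r//.
by have := b_ge0 w; lra.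
Qed.

Lemma green_unique w v x : W w -> exp_bounded (b w) x ->
  solution_at theta Phi w (impulse v) x -> forall n, x n = G w v n.
Proof.
move=> Ww bx sx; apply: (solution_at_unique _ bx _ sx (solG v Ww)).
  by move=> z; exact: unique0.
exact: exp_bounded_green.
Qed.

Lemma green_linear w n : W w -> linear (G w ^~ n).
Proof.
move=> Ww a u v; apply/esym.
apply: (green_unique (x := fun k => a *: G w u k + G w v k) Ww).
  by apply: exp_bounded_comb; apply: exp_bounded_green.
move=> k; rewrite (solution_at_comb a (solG u Ww) (solG v Ww)).
by rewrite /impulse; case: ifP; rewrite // scaler0 addr0.
Qed.

(** The response restricted to nonnegative times is the response to its own
    value at time 0. *)
Lemma green_idem w v : W w -> G w (G w v 0) 0 = G w v 0.
Proof.
move=> Ww; pose x (n : int) : X := if 0 <= n then G w v n else 0.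
rewrite -(green_unique (x := x) Ww) //.
  have [C xC] := exp_bounded_green v Ww; exists C => n.
  rewrite /x; case: ifP => // _; rewrite normr0.
  exact: le_trans (xC n).
move=> n; rewrite /x /impulse.
have [n0|[n0|n0]] : 0 <= n \/ n = -1 \/ n < -1 by lia.
- have -> : 0 <= n + 1 by lia.
  have -> : (n + 1 == 0) = false by lia.
  by rewrite n0 (solG v Ww) /impulse (_ : (n + 1 == 0) = false)//; lia.
- by rewrite n0 linear0 add0r.
- have -> : (0 <= n + 1) = false by lia.
  have -> : (n + 1 == 0) = false by lia.
  have -> : (0 <= n) = false by lia.
  by rewrite linear0 addr0.
Qed.

Lemma green_commute1 w v : W w ->
  G (theta w) (generator Phi w v) 0 = generator Phi w (G w v 0).
Proof.
move=> Ww; have W1 : W (iterZ theta 1 w) by exact: invariant_set_iterZ.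
(* At w, removing v at time 0 moves the impulse to time 1, that is, to time 0
   along the orbit of theta w. *)
pose y n := -1 *: impulse v (1 + n) + G w v (1 + n).
rewrite -[theta w]/(iterZ theta 1 w) -(green_unique (x := y) W1).
- rewrite /y /impulse /= scaler0 add0r addr0.
  by rewrite -[1]add0r (solG v Ww) addr0.
- rewrite /y invariant_fun_iterZ//.
  apply: (exp_bounded_shift 1
    (x := fun n => -1 *: impulse v n + G w v n)) => //.
  by apply: exp_bounded_comb;
    [exact: exp_bounded_impulse|exact: exp_bounded_green].
move=> n; rewrite /y addrA (solG v Ww) linearP iterZD !scaleN1r.
rewrite addrCA addNr addr0 addrC -addrA addrCA -[LHS]addr0; congr (_ + _).
rewrite /impulse (_ : (n + 1 == 0) = (1 + n == 0)); last by lia.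
case: eqP => [n1|_].
  have -> : n = -1 by lia.
  by rewrite -iterZD addNr.
by rewrite linear0 oppr0 addr0.
Qed.

Lemma green_commute w v (n : nat) : W w ->
  G (iterZ theta n w) (Phi n w v) 0 = Phi n w (G w v 0).
Proof.
have [Phi0 PhiD _] := cocyclePhi.
move=> Ww; elim: n => [|n IH]; first by rewrite !Phi0.
have -> : Posz n.+1 = n%:Z + 1 by lia.
rewrite -addn1 !PhiD iterZS green_commute1; last exact: invariant_set_iterZ.
by rewrite IH.
Qed.

Lemma green_forward w v (n : nat) : W w -> G w v n = Phi n w (G w v 0).
Proof.
move=> Ww; rewrite -[Posz n]add0r.
rewrite (orbit_segment (w := w) (m := 0) (x := G w v) cocyclePhi)//.
move=> k _; rewrite (solG v Ww) /impulse (_ : (0 + k%:Z + 1 == 0) = false).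
  by rewrite addr0.
by lia.
Qed.

(** The range of the complementary projection, see [range_compl_proj]. *)
Definition unstable w : set X := [set v | G w v 0 = 0].

(** Reducing to one step keeps the argument free of estimates: the forcing of
    [impulse v - G w v] is concentrated at time 1 and equals [- A (w) v]. *)
Lemma unstable_inj1 w v :
  W w -> unstable w v -> generator Phi w v = 0 -> v = 0.
Proof.
move=> Ww Uv Av0; pose z n := -1 *: G w v n + impulse v n.
have z0 : z 0 = 0.
  apply: (unique0 (w := w)) => //.
    by apply: exp_bounded_comb;
      [exact: exp_bounded_green|exact: exp_bounded_impulse].
  move=> n; rewrite /z (solG v Ww) linearP !scaleN1r opprD -!addrA addNr.
  congr (_ + _); rewrite addr0 /impulse.
  by case: eqP => [->|_]; rewrite ?linear0 ?addr0.
by move: z0; rewrite /z Uv scaler0 add0r.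
Qed.

Lemma unstable_phi w v (n : nat) :
  W w -> unstable w v -> unstable (iterZ theta n w) (Phi n w v).
Proof. by move=> Ww Uv; rewrite /unstable/= green_commute// Uv linear0. Qed.

Lemma unstable_inj w v (n : nat) :
  W w -> unstable w v -> Phi n w v = 0 -> v = 0.
Proof.
have [Phi0 PhiD _] := cocyclePhi.
move=> Ww Uv; elim: n => [|n IH]; first by rewrite Phi0.
rewrite -addn1 PhiD => /unstable_inj1 v0; apply: IH; apply: v0.
  exact: invariant_set_iterZ.
exact: unstable_phi.
Qed.

(** The opposite of the backward orbit, continued by 0 from time 0 on, jumps by
    [y 0] at time 0: it is the response to [y 0], and it vanishes there. *)
Lemma unstable_of_backward_orbit w (y : int -> X) :
  W w -> exp_bounded (b w) y ->
  (forall n, n < 0 -> y (n + 1) = generator Phi (iterZ theta n w) (y n)) ->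
  unstable w (y 0).
Proof.
move=> Ww [C yC] yS; pose x (n : int) : X := if n < 0 then - y n else 0.
rewrite /unstable/= -(green_unique (x := x) Ww)//.
  exists C => n; rewrite /x; case: ifP => _; first by rewrite normrN.
  by rewrite normr0 (le_trans _ (yC n)).
move=> n; rewrite /x /impulse.
have [n0|[n0|n0]] : 0 <= n \/ n = -1 \/ n < -1 by lia.
- have -> : (n + 1 < 0) = false by lia.
  have -> : (n + 1 == 0) = false by lia.
  have -> : (n < 0) = false by lia.
  by rewrite linear0 addr0.
- by rewrite n0 linearN -(yS (-1))// addNr /= addNr.
- have n1 : n + 1 < 0; first lia.
  rewrite n1.
  have -> : (n + 1 == 0) = false by lia.
  have n2 : n < 0 by lia.
  by rewrite n2 linearN yS// addr0.
Qed.

(** For [n <= 0], the value at time [n] of the backward orbit of the unstable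
    component of [v]; the impulse only contributes at time 0. *)
Definition backward w v (n : int) : X := impulse v n - G w v n.

Lemma backwardS w v n : W w -> n < 0 ->
  backward w v (n + 1) = generator Phi (iterZ theta n w) (backward w v n).
Proof.
move=> Ww n0; rewrite /backward (solG v Ww) {3}/impulse lt_eqF// sub0r linearN.
by rewrite opprD addrCA subrr addr0.
Qed.

Lemma backward_le w v (n : nat) : W w ->
  `|backward w v (- n%:Z)| <= (1 + M w) * expR (b w * - n%:R) * `|v|.
Proof.
move=> Ww; rewrite (le_trans (ler_normB _ _))// 2!mulrDl mul1r lerD//.
  rewrite /impulse; case: ifP => [|_].
    by rewrite oppr_eq0 => /eqP[->]; rewrite oppr0 mulr0 expR0 mul1r.
  by rewrite normr0 mulr_ge0// expR_ge0.
rewrite (le_trans (decayG _ _ Ww))// intrN normrN mulrN mulNr.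
by rewrite ger0_norm.
Qed.

Lemma unstable_backward w v (n : nat) : W w ->
  unstable (iterZ theta (- n%:Z) w) (backward w v (- n%:Z)).
Proof.
move=> Ww; rewrite -[X in backward w v X]addr0.
apply: (unstable_of_backward_orbit (y := fun k => backward w v (- n%:Z + k))).
- exact: invariant_set_iterZ.
- rewrite invariant_fun_iterZ//; apply: exp_bounded_shift => //.
  have [C GC] := exp_bounded_green v Ww.
  have [D ID] := exp_bounded_impulse (b w) v.
  exists (D + C) => k.
  by rewrite mulrDl (le_trans (ler_normB _ _))// lerD.
- by move=> k k0; rewrite addrA backwardS ?iterZD//; lia.
Qed.

Lemma phi_backward w v (n : nat) : W w ->
  Phi n (iterZ theta (- n%:Z) w) (backward w v (- n%:Z)) = v - G w v 0.
Proof.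
move=> Ww; rewrite -(orbit_segment (x := backward w v) cocyclePhi).
  by rewrite addNr.
by move=> k kn; apply: backwardS => //; lia.
Qed.

Lemma green_projection : exists Ps : Omega -> bounded_operator X,
  forall w v, W w -> Ps w v = G w v 0.
Proof.
have /choice[Ps PsG] : forall w, exists T : bounded_operator X,
    W w -> forall v, T v = G w v 0.
  move=> w; have [Ww|nW] := pselect (W w); last first.
    have [||T _] := @bounded_operator_of R X (fun=> 0); last by exists T.
      by move=> a u v; rewrite scaler0 addr0.
    by exists 0 => x _; rewrite normr0 mul0r.
  have [||T TG] := @bounded_operator_of R X (G w ^~ 0); last by exists T.
    exact: green_linear.
  exists (M w) => v _; rewrite (le_trans (decayG _ _ Ww))//.
  by rewrite normr0 mulr0 expR0 mulr1.
by exists Ps => w v Ww; apply: PsG.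
Qed.

Section projection.
Context {Ps : Omega -> bounded_operator X}.
Hypothesis PsG : forall w v, W w -> Ps w v = G w v 0.

Lemma range_compl_proj w : W w -> range (compl_proj Ps w) = unstable w.
Proof.
move=> Ww; rewrite /unstable; apply/seteqP; split=> [_ [v _ <-]|v /= Gv0].
  by rewrite /= /compl_proj -PsG// linearB !PsG// green_idem// subrr.
by exists v => //; rewrite /compl_proj PsG// Gv0 subr0.
Qed.

Lemma phi_inj_unstable w n : W w -> {in unstable w &, injective (Phi n w)}.
Proof.
move=> Ww u v; rewrite !inE /unstable/= => Gu Gv e.
apply/eqP; rewrite -subr_eq0; apply/eqP; apply: (unstable_inj (n := n) Ww).
  by rewrite /unstable/= -PsG// linearB !PsG// Gu Gv subrr.
by rewrite linearB e subrr.
Qed.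

Lemma cocycle_bwd_eq w v (n : nat) : W w ->
  cocycle_bwd theta Phi Ps n w (compl_proj Ps w v) = backward w v (- n%:Z).
Proof.
move=> Ww.
have W' : W (iterZ theta (- n%:Z) w) by exact: invariant_set_iterZ.
rewrite /cocycle_bwd /compl_proj PsG// -(phi_backward v n Ww) /inv_on.
rewrite range_compl_proj// pinvKV//; first exact: phi_inj_unstable.
by rewrite inE; exact: unstable_backward.
Qed.

Lemma phi_isomorphism_unstable w (n : nat) : W w ->
  isomorphism_on (range (compl_proj Ps w))
    (range (compl_proj Ps (iterZ theta n w))) (Phi n w).
Proof.
move=> Ww.
have W' : W (iterZ theta n w) by exact: invariant_set_iterZ.
have back : iterZ theta (- n%:Z) (iterZ theta n w) = w by rewrite -iterZD subrr.
rewrite !range_compl_proj//; split.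
- split; first by move=> v; exact: unstable_phi.
    exact: phi_inj_unstable.
  move=> v Gv; exists (backward (iterZ theta n w) v (- n%:Z)).
    by rewrite -{1}back; exact: unstable_backward.
  by rewrite -{1}back phi_backward// Gv subr0.
- by have [C PhiC] := bop_bounded (Phi n w); exists C => v _; exact: PhiC.
- exists ((1 + M (iterZ theta n w)) * expR (b (iterZ theta n w) * - n%:R)).
  move=> v Gv; rewrite (le_trans _ (backward_le v n W'))//.
  rewrite -cocycle_bwd_eq// /cocycle_bwd back range_compl_proj//.
  by rewrite /compl_proj PsG// Gv subr0.
Qed.

End projection.

Lemma dichotomy_of_green : full_measure P W ->
  (forall v n, borel_measurable_on W (fun w => G w v n)) ->
  positive_rv b -> measurable_fun setT M -> tempered theta (fun w => 1 + M w) ->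
  tempered_exponential_dichotomy theta Phi.
Proof.
move=> fullW mG b_rv mM tM; have [Ps PsG] := green_projection.
have eq_meas (g h : Omega -> X) : (forall w, W w -> g w = h w) ->
    borel_measurable_on W g -> borel_measurable_on W h.
  by move=> gh; apply: eq_measurable_fun => w; rewrite inE => /gh.
exists W, Ps; split.
- split=> // v; apply: eq_meas (mG v 0) => w Ww; exact/esym/PsG.
- by move=> w Ww v; rewrite !PsG// green_idem.
- move=> w Ww n v; have Wn : W (iterZ theta n w) by exact: invariant_set_iterZ.
  by rewrite !PsG// green_commute.
- split=> [w Ww n|n v]; first exact: phi_isomorphism_unstable.
  apply: (@eq_meas (fun w => impulse v (- n%:Z) - G w v (- n%:Z))).
    by move=> w Ww; rewrite /= cocycle_bwd_eq.
  apply: (borel_measurable_on_comp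
    (h := fun x => impulse v (- n%:Z) - x)) (mG v (- n%:Z)).
  by move=> x; apply: cvgB; [exact: cvg_cst|exact: cvg_id].
exists b, (fun w => 1 + M w); split=> //.
- split=> //; split; first by apply: measurable_funD.
  by move=> w; rewrite ltr_pwDl.
- move=> w Ww n; apply: opnorm_le => [|v].
    by rewrite mulr_ge0 ?expR_ge0// addr_ge0.
  rewrite /= PsG// -green_forward// (le_trans (decayG _ _ Ww))//.
  by rewrite ger0_norm// !ler_wpM2r ?expR_ge0// lerDr.
- move=> w Ww n; apply: opnorm_le => [|v].
    by rewrite mulr_ge0 ?expR_ge0// addr_ge0.
  by rewrite /= cocycle_bwd_eq// backward_le.
Qed.

End green.

(** * Temperedness *)

Section temperedness.
Context {R : realType}.

Lemma ln_addr1_le (a : R) : 0 < a -> 0 <= ln (1 + a) <= ln 2 + `|ln a|.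
Proof.
move=> a0; have a1 : 0 < 1 + a by rewrite addr_gt0.
rewrite ln_ge0/=; last by rewrite lerDl ltW.
have [ale1|age1] := leP a 1.
  by rewrite ler_wpDr// ler_ln ?posrE//; lra.
have -> : `|ln a| = ln a by rewrite ger0_norm// ln_ge0// ltW.
by rewrite -lnM ?posrE// ler_ln ?posrE ?mulr_gt0//; lra.
Qed.

(** With [s n = n] and [s n = - n] this covers both time directions of
    temperedness.  Up to a constant, which disappears after division by [s n],
    the new logarithm is at most the absolute value of the old one. *)
Lemma log_growth_affine (u s : nat -> R) (c : R) :
  0 < c -> (forall n, 0 < u n) -> (s n)^-1 @[n --> \oo] --> 0 ->
  ln (u n) / s n @[n --> \oo] --> 0 ->
  ln (1 + c * u n) / s n @[n --> \oo] --> 0.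
Proof.
move=> c0 u0 s0 us0; apply/norm_cvg0P.
pose D := ln 2 + `|ln c|.
apply: (@squeeze_cvgr _ _ _ _ (fun=> 0)
    (fun n => D * `|(s n)^-1| + `|ln (u n) / s n|)).
- near=> n; rewrite normr_ge0 !normrM -mulrDl ler_wpM2r//.
  have cu0 : 0 < c * u n by rewrite mulr_gt0.
  have /andP[l0 lle] := ln_addr1_le cu0.
  rewrite ger0_norm// (le_trans lle)// /D -addrA lerD2l.
  by rewrite lnM ?posrE// ler_normD.
- exact: cvg_cst.
- rewrite -[X in _ --> X](addr0 0); apply: cvgD; last exact/norm_cvg0P.
  by rewrite -(mulr0 D); apply: cvgMr; exact/norm_cvg0P.
Unshelve. all: by end_near. Qed.

Lemma cvg_invr_nat : (n%:R^-1 : R) @[n --> \oo] --> 0.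
Proof.
by rewrite -(cvg_shiftS (fun n => n%:R^-1 : R)); exact: cvg_harmonic.
Qed.

Lemma tempered_affine {d : measure_display} {Omega : measurableType d}
    {P : {measure set Omega -> \bar R}} (theta : invertible_mpt P)
    (g K : Omega -> R) :
  invariant_fun theta g -> (forall w, 0 < g w) -> (forall w, 0 < K w) ->
  tempered theta K -> tempered theta (fun w => 1 + g w * K w).
Proof.
move=> ginv g0 K0; rewrite /tempered.
apply: (@filterS _ _ (ae_filter_ringOfSetsType P)) => w [Kp Kn]; split.
- under eq_cvg do rewrite invariant_fun_iterZ//.
  exact: log_growth_affine cvg_invr_nat Kp.
- under eq_cvg do rewrite invariant_fun_iterZ//.
  apply: log_growth_affine Kn => //.
  under eq_cvg do rewrite invrN.
  by have := cvgN cvg_invr_nat; rewrite oppr0; apply.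
Qed.

End temperedness.

(** * From admissibility to a decaying impulse response *)

Section admissibility.
Context {d : measure_display} {Omega : measurableType d} {R : realType}.
Context {P : {measure set Omega -> \bar R}} {theta : invertible_mpt P}.
Context {X : completeNormedModType R}.
Context {Phi : nat -> Omega -> bounded_operator X}.
Context {W : set Omega}.

Lemma ereal_sup_range_le {I : Type} (u : I -> R) (C : R) :
  (ereal_sup (range (fun i => (u i)%:E)) <= C%:E)%E <-> forall i, u i <= C.
Proof.
split=> [uC i|uC].
  by rewrite -lee_fin (le_trans _ uC)//; apply: ereal_sup_ubound; exists i.
by apply: ge_ereal_sup => _ [i _ <-]; rewrite lee_fin.
Qed.

Lemma ereal_sup_range_lty {I : Type} (i0 : I) (u : I -> R) :
  (ereal_sup (range (fun i => (u i)%:E)) < +oo)%E <->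
  exists C, forall i, u i <= C.
Proof.
split=> [|[C uC]]; last first.
  by rewrite (@le_lt_trans _ _ C%:E) ?ltry//; apply/ereal_sup_range_le.
case E : ereal_sup => [C||]// _.
  by exists C; apply/ereal_sup_range_le; rewrite E.
have : ((u i0)%:E <= -oo)%E by rewrite -E; apply: ereal_sup_ubound; exists i0.
by [].
Qed.

Lemma seqnorm_abs1_lty (b : R) w (x : int -> X) :
  (seqnorm_abs theta (fun=> 1%R) b w x < +oo)%E <-> exp_bounded b x.
Proof.
split=> [/(ereal_sup_range_lty 0)[C xC]|[C xC]].
  exists C => n; have := xC n; rewrite mul1r mulNr expRN mulrC.
  by rewrite ler_pdivrMr// expR_gt0.
apply/(ereal_sup_range_lty 0); exists C => n.
by rewrite mul1r mulNr expRN mulrC ler_pdivrMr ?expR_gt0.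
Qed.

Lemma seqnorm1_le (b : R) w (x : int -> X) (C : R) :
  (seqnorm theta (fun=> 1%R) b w x <= C%:E)%E <->
  forall n, `|x n| <= C * expR (b * n%:~R).
Proof.
split=> [/ereal_sup_range_le xC n|xC].
  have := xC n; rewrite mul1r mulNr expRN mulrC.
  by rewrite ler_pdivrMr// expR_gt0.
apply/ereal_sup_range_le => n.
by rewrite mul1r mulNr expRN mulrC ler_pdivrMr ?expR_gt0.
Qed.

Lemma seqnorm_impulse_le (K : Omega -> R) (b : R) w (v : X) :
  0 <= K w -> (seqnorm theta K b w (impulse v) <= (K w * `|v|)%:E)%E.
Proof.
move=> K0; apply/ereal_sup_range_le => n; rewrite /impulse.
case: eqP => [->|_]; first by rewrite mulr0 expR0 mulr1.
by rewrite normr0 mulr0 mulr_ge0.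
Qed.

(** Admissibility speaks of families indexed by the whole of [W], without any
    measurability of the forcing; a single sequence can therefore be extended
    by 0 to the other points, and two solutions at [w] can be compared after
    extending them by the same family. *)
Lemma admissible_pointwise (N N' : Omega -> set (int -> X)) w f :
  properly_admissible theta Phi W [set f | forall w, W w -> N w (f w)]
    [set x | forall w, W w -> N' w (x w)] ->
  (forall w, W w -> N w (fun=> 0)) -> W w -> N w f ->
  exists x, [/\ N' w x, solution_at theta Phi w f x &
    forall y, N' w y -> solution_at theta Phi w f y -> forall n, y n = x n].
Proof.
move=> adm N0 Ww Nf; pose F w' := if pselect (w' = w) then f else fun=> 0.
have Fw : F w = f by rewrite /F; case: pselect.
have [|x [N'x sx ux]] := adm F.
  move=> w' Ww'; rewrite /F; case: pselect => [e|_] /=; first by rewrite e.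
  exact: N0.
exists (x w); split; [exact: N'x|by rewrite -Fw; exact: sx|move=> y N'y sy n].
pose Y w' := if pselect (w' = w) then y else x w'.
have Yw : Y w = y by rewrite /Y; case: pselect.
rewrite -Yw; apply: ux => // w' Ww'; rewrite /Y; case: pselect => [e|_] /=.
- by rewrite e.
- exact: N'x.
- by rewrite e Fw.
- exact: sx.
Qed.

Lemma seqnorm0_lty (K : Omega -> R) (b : R) w :
  (seqnorm theta K b w ((fun=> 0%R) : int -> X) < +oo)%E.
Proof.
by apply/(ereal_sup_range_lty 0); exists 0 => n; rewrite normr0 mulr0.
Qed.

Lemma impulse_response_exp (K lambda gamma : Omega -> R) :
  (forall w, 0 < K w) ->
  properly_admissible theta Phi W
    (linfty theta W K lambda) (linfty theta W (fun=> 1%R) lambda) ->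
  (forall w, W w -> forall f x : int -> X,
    (seqnorm theta K (lambda w) w f < +oo)%E ->
    (seqnorm theta (fun=> 1%R) (lambda w) w x < +oo)%E ->
    solution_at theta Phi w f x ->
    (seqnorm theta (fun=> 1%R) (lambda w) w x <=
     (gamma w)%:E * seqnorm theta K (lambda w) w f)%E) ->
  (forall w, 0 < gamma w) ->
  forall w v, W w -> exists2 x, solution_at theta Phi w (impulse v) x &
    forall n, `|x n| <= gamma w * (K w * `|v|) * expR (lambda w * n%:~R).
Proof.
move=> K0 adm bnd gamma0 w v Ww.
have fK : (seqnorm theta K (lambda w) w (impulse v) <= (K w * `|v|)%:E)%E.
  by apply: seqnorm_impulse_le; rewrite ltW.
have flty := le_lt_trans fK (ltry _).
have [|x [xlty sx _]] := @admissible_pointwise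
    (fun w f => (seqnorm theta K (lambda w) w f < +oo)%E)
    (fun w x => (seqnorm theta (fun=> 1%R) (lambda w) w x < +oo)%E) w
    (impulse v) adm _ Ww flty.
  by move=> *; exact: seqnorm0_lty.
exists x => //; apply/(seqnorm1_le _ w).
rewrite (le_trans (bnd _ Ww _ _ flty xlty sx))//.
by rewrite EFinM lee_wpmul2l// lee_fin ltW.
Qed.

(** The case of an arbitrary forcing, whatever its [K]-weighted norm, follows
    by subtraction ([solution_at_unique]). *)
Lemma bounded_homogeneous_zero (K b : Omega -> R) :
  properly_admissible theta Phi W
    (linfty_abs theta W K b) (linfty_abs theta W (fun=> 1%R) b) ->
  forall w x, W w -> exp_bounded (b w) x ->
  solution_at theta Phi w (fun=> 0) x -> forall n, x n = 0.
Proof.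
move=> adm w x Ww bx sx n.
have zlty K' w' :
    (seqnorm_abs theta K' (b w') w' ((fun=> 0%R) : int -> X) < +oo)%E.
  by apply/(ereal_sup_range_lty 0); exists 0 => k; rewrite normr0 mulr0.
have [|y [_ _ uy]] := @admissible_pointwise
    (fun w f => (seqnorm_abs theta K (b w) w f < +oo)%E)
    (fun w x => (seqnorm_abs theta (fun=> 1%R) (b w) w x < +oo)%E) w
    (fun=> 0) adm _ Ww (zlty _ _).
  by move=> *; exact: zlty.
rewrite (uy x)//; last exact/seqnorm_abs1_lty.
by rewrite -(uy (fun=> 0))// => k; rewrite linear0 addr0.
Qed.

(** The two responses, at the rates [b] ([i = false]) and [- b] ([i = true]),
    coincide by uniqueness; the first is small at negative times and the
    second at positive times. *)
Lemma exists_green (K b : Omega -> R) (g : bool -> Omega -> R) :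
  (forall w, 0 <= b w) -> (forall w, 0 < K w) -> (forall i w, 0 < g i w) ->
  (forall i w v, W w -> exists2 x, solution_at theta Phi w (impulse v) x &
    forall n, `|x n| <=
      g i w * (K w * `|v|) * expR ((-1) ^+ i * b w * n%:~R)) ->
  properly_admissible theta Phi W
    (linfty_abs theta W K b) (linfty_abs theta W (fun=> 1%R) b) ->
  exists G : Omega -> X -> int -> X, forall w v, W w ->
    solution_at theta Phi w (impulse v) (G w v) /\
    forall n, `|G w v n| <=
      (g false w + g true w) * K w * expR (- b w * `|n%:~R|) * `|v|.
Proof.
move=> b0 K0 g0 resp adm.
have /choice[G GP] : forall wv : Omega * X, exists x, W wv.1 ->
    solution_at theta Phi wv.1 (impulse wv.2) x /\
    forall n, `|x n| <= (g false wv.1 + g true wv.1) * K wv.1 *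
      expR (- b wv.1 * `|n%:~R|) * `|wv.2|.
  move=> [w v] /=; have [Ww|nW] := pselect (W w); last by exists (fun=> 0).
  have C0 i : 0 <= g i w * (K w * `|v|).
    by rewrite !mulr_ge0// ltW.
  have [x sx xb] := resp false w v Ww; have [y sy yb] := resp true w v Ww.
  have xy : x =1 y.
    apply: (solution_at_unique _ _ _ sx sy).
    - by move=> z; exact: (bounded_homogeneous_zero adm).
    - exists (g false w * (K w * `|v|)) => n; rewrite (le_trans (xb n))//.
      by rewrite ler_wpM2l// ler_expR expr0 mul1r ler_wpM2l// ler_norm.
    - exists (g true w * (K w * `|v|)) => n; rewrite (le_trans (yb n))//.
      rewrite ler_wpM2l// ler_expR expr1 mulN1r mulNr -mulrN ler_wpM2l//.
      by rewrite -normrN ler_norm.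
  exists x => _; split=> // n.
  have -> : (g false w + g true w) * K w * expR (- b w * `|n%:~R|) * `|v| =
      (g false w * (K w * `|v|) + g true w * (K w * `|v|)) *
      expR (- b w * `|n%:~R|).
    by ring.
  have [n0|n0] := leP 0 (n%:~R : R).
    rewrite (ger0_norm n0) mulrDl xy (le_trans (yb n))// expr1 mulN1r.
    by rewrite lerDr mulr_ge0// expR_ge0.
  rewrite (ltr0_norm n0) mulrDl (le_trans (xb n))// expr0 mul1r mulrNN.
  by rewrite lerDl mulr_ge0// expR_ge0.
by exists (fun w v => G (w, v)) => w v Ww; exact: (GP (w, v)).
Qed.

End admissibility.

Theorem theorem2 (R : realType) (X : completeNormedModType R)
  (sepX : separable X)
  (d : measure_display) (Omega : measurableType d)
  (P : {measure set Omega -> \bar R}) (theta : invertible_mpt P)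
  (Phi : nat -> Omega -> bounded_operator X)
  (cocyclePhi : is_cocycle theta Phi)
  (W : set Omega) (invW : invariant_set theta W) (fullW : full_measure P W)
  (beta : Omega -> R) (beta_rv : positive_rv beta)
  (beta_inv : invariant_fun theta beta)
  (K : Omega -> R) (K_rv : positive_rv K) (K_tempered : tempered theta K)
  (S1 : forall lambda : Omega -> R,
    lambda = beta \/ lambda = (fun w => - beta w) ->
    measurably_properly_admissible theta Phi W
      (linfty theta W K lambda) (linfty theta W (fun=> 1%R) lambda) /\
    exists gamma : Omega -> R,
      [/\ positive_rv gamma, invariant_fun theta gamma &
        forall w, W w -> forall f x : int -> X,
          (seqnorm theta K (lambda w) w f < +oo)%E ->
          (seqnorm theta (fun=> 1%R) (lambda w) w x < +oo)%E ->
          solution_at theta Phi w f x ->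
          (seqnorm theta (fun=> 1%R) (lambda w) w x <=
           (gamma w)%:E * seqnorm theta K (lambda w) w f)%E])
  (S2 : properly_admissible theta Phi W
    (linfty_abs theta W K beta) (linfty_abs theta W (fun=> 1%R) beta)) :
  tempered_exponential_dichotomy theta Phi.
Proof.
have [mbeta beta0] := beta_rv; have [mK K0] := K_rv.
have [[adm_f meas_f] [gf [[mgf gf0] gf_inv gfP]]] := S1 _ (or_introl erefl).
have [[adm_b _] [gb [[mgb gb0] gb_inv gbP]]] := S1 _ (or_intror erefl).
pose g (i : bool) := if i then gb else gf.
have beta_ge0 w : 0 <= beta w by exact: ltW.
have g0 i w : 0 < g i w by case: i; rewrite /g.
have [//|G GP] := exists_green beta_ge0 K0 g0 _ S2.
  case=> w v Ww.
    rewrite expr1 mulN1r; exact: (impulse_response_exp K0 adm_b gbP gb0).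
  rewrite expr0 mul1r; exact: (impulse_response_exp K0 adm_f gfP gf0).
pose M w := (g false w + g true w) * K w.
have M0 w : 0 <= M w by rewrite mulr_ge0 ?addr_ge0// ltW.
apply: (dichotomy_of_green cocyclePhi (b := beta) (M := M) (G := G) invW) => //.
- exact: bounded_homogeneous_zero S2.
- by move=> w v /(GP w v)[].
- by move=> w v n /(GP w v)[].
- move=> v n; apply: (meas_f (fun=> impulse v) _ _ (fun w => G w v)).
  + move=> w Ww; apply: le_lt_trans (seqnorm_impulse_le _ _ _) (ltry _).
    exact: ltW.
  + by move=> k; exact: measurable_cst.
  + move=> w Ww; have [_ Gb] := GP w v Ww.
    apply: (@le_lt_trans _ _ (M w * `|v|)%:E); last exact: ltry.
    apply/seqnorm1_le => k; rewrite (le_trans (Gb k))// -/(M w) mulrAC.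
    rewrite (ler_wpM2l (mulr_ge0 (M0 w) _))// ler_expR mulNr -mulrN ler_wpM2l//.
    by rewrite lerNl -normrN ler_norm.
  + by move=> w Ww; have [] := GP w v Ww.
- by apply: measurable_funM => //; apply: measurable_funD.
- apply: tempered_affine => // w; first by rewrite /= gf_inv gb_inv.
  by rewrite addr_gt0.
Qed.
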